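(* Let a prior network with boundary conditions and positive weights $d_{kl}$ be given. For $K>0$, call a physical network $(\kappa_{kl})$ minimally dissipative with material constraint $K$ if $\sum_{k>l,\langle k,l\rangle=1}\kappa_{kl}^{1/2}d_{kl}=K$ and it globally minimizes $$D=\sum_{k>l,\langle k,l\rangle=1}\frac{Q_{kl}^2}{\kappa_{kl}}$$ among all physical networks satisfying this constraint. For $a>0$, call a physical network minimally dissipative with material penalty under coefficient $a$ if it globally minimizes $$\Theta=\sum_{k>l,\langle k,l\rangle=1}\frac{Q_{kl}^2}{\kappa_{kl}}+a\sum_{k>l,\langle k,l\rangle=1}\kappa_{kl}^{1/2}d_{kl}$$ among all physical networks. Here $Q_{kl}$ is always the Kirchhoff flow of the network in question. Suppose that the flows in each network that is minimally dissipative with material constraint $K$ (for any $K>0$) are invariant when conductances are uniformly rescaled, i.e. for every such network $(\kappa_{kl})$ and every $\beta>0$ the network $(\beta\kappa_{kl})$ has the same Kirchhoff flow as $(\kappa_{kl})$. Then there is a bijection $a\mapsto K(a)$ from $(0,\infty)$ to $(0,\infty)$ such that every network that is minimally dissipative with material constraint $K=K(a)$ is minimally dissipative with material penalty under the coefficient $a$, and vice versa.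
   Context: Prior network: a finite simple undirected graph on vertices $1,\dots,V$; $\langle k,l\rangle=1$ means $k,l$ are joined by an edge ($\langle k,l\rangle=\langle l,k\rangle$), and $\langle k,l\rangle=0$ otherwise. Each edge carries a fixed weight $d_{kl}=d_{lk}>0$. Boundary conditions: disjoint vertex sets $\mathcal P$ (pressure vertices, each with prescribed pressure $\bar p_k\in\mathbb R$) and $\mathcal F$ (flow vertices, each with prescribed inflow $q_k\in\mathbb R$). Put $q_k=0$ for $k\notin\mathcal P\cup\mathcal F$. A network is a choice of conductances $\kappa_{kl}=\kappa_{lk}\ge 0$ on the edges. A Kirchhoff flow is $Q_{kl}=(p_k-p_l)\kappa_{kl}$ on the edges (so $Q_{kl}=-Q_{lk}$), where the pressures $p_k$ satisfy $p_k=\bar p_k$ for $k\in\mathcal P$ and $\sum_{l:\langle k,l\rangle=1}(p_k-p_l)\kappa_{kl}=q_k$ for $k\notin\mathcal P$. The network is physical if there is exactly one Kirchhoff flow (equivalently, every connected component of the graph formed by all vertices and the edges with $\kappa_{kl}>0$ contains a vertex of $\mathcal P$ or has total prescribed inflow zero). Convention: a term $Q_{kl}^2/\kappa_{kl}$ with $\kappa_{kl}=0$ and $Q_{kl}=0$ is $0$.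
   Formalization: Adds the hypothesis that some flow vertex has nonzero prescribed inflow; if all inflows vanish, the network with all conductances zero minimizes Θ for every a but has material 0, so the ''vice versa'' fails for every bijection. *)

(* Defs.v *)
From HB Require Import structures.
From mathcomp Require Import all_boot all_order all_algebra.
From mathcomp Require Import all_classical all_reals.

Set Implicit Arguments.
Unset Strict Implicit.
Unset Printing Implicit Defensive.

Import Order.TTheory GRing.Theory Num.Theory.
Local Open Scope ring_scope.

(* [weight] is only meaningful on edges, [pressure] on [pressureV] and
   [prescribed_inflow] on [flowV]; other values are never used. *)
Record prior_network (R : realType) (V : nat) := PriorNetwork {
  edge : rel 'I_V;
  edge_sym : forall k l, edge k l = edge l k;
  edge_irr : forall k, ~~ edge k k;
  weight : 'I_V -> 'I_V -> R;
  weight_sym : forall k l, edge k l -> weight k l = weight l k;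
  weight_gt0 : forall k l, edge k l -> 0 < weight k l;
  pressureV : {set 'I_V};
  flowV : {set 'I_V};
  bc_disjoint : [disjoint pressureV & flowV];
  pressure : 'I_V -> R;
  prescribed_inflow : 'I_V -> R
}.

Section Network.
Variables (R : realType) (V : nat) (N : prior_network R V).

Definition inflow (k : 'I_V) : R :=
  if k \in flowV N then prescribed_inflow N k else 0.

(* Conductances live on edges; the matrix is extended by 0 elsewhere, so that
   distinct matrices represent distinct networks. *)
Definition is_network (kappa : 'M[R]_V) : Prop :=
  [/\ forall k l, kappa k l = kappa l k,
      forall k l, 0 <= kappa k l &
      forall k l, ~~ edge N k l -> kappa k l = 0].

Definition kirchhoff_flow (kappa Q : 'M[R]_V) : Prop :=
  exists p : 'I_V -> R,
  [/\ forall k l, Q k l = if edge N k l then (p k - p l) * kappa k l else 0,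
      forall k, k \in pressureV N -> p k = pressure N k &
      forall k, k \notin pressureV N ->
        \sum_(l | edge N k l) (p k - p l) * kappa k l = inflow k].

Definition physical (kappa : 'M[R]_V) : Prop :=
  is_network kappa /\ exists! Q : 'M[R]_V, kirchhoff_flow kappa Q.

(* For a Kirchhoff flow Q, kappa k l = 0 forces Q k l = 0, and the term is
   then 0 because 0 / 0 = 0 in MathComp. *)
Definition dissipation (kappa Q : 'M[R]_V) : R :=
  \sum_(k < V) \sum_(l < V | (l < k)%N && edge N k l)
    Q k l ^+ 2 / kappa k l.

Definition material (kappa : 'M[R]_V) : R :=
  \sum_(k < V) \sum_(l < V | (l < k)%N && edge N k l)
    Num.sqrt (kappa k l) * weight N k l.

Definition min_dissipative_constraint (K : R) (kappa : 'M[R]_V) : Prop :=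
  [/\ physical kappa, material kappa = K &
      forall kappa' : 'M[R]_V, physical kappa' -> material kappa' = K ->
      forall Q Q' : 'M[R]_V,
        kirchhoff_flow kappa Q -> kirchhoff_flow kappa' Q' ->
        dissipation kappa Q <= dissipation kappa' Q'].

Definition min_dissipative_penalty (a : R) (kappa : 'M[R]_V) : Prop :=
  physical kappa /\
  forall kappa' : 'M[R]_V, physical kappa' ->
  forall Q Q' : 'M[R]_V,
    kirchhoff_flow kappa Q -> kirchhoff_flow kappa' Q' ->
    dissipation kappa Q + a * material kappa
      <= dissipation kappa' Q' + a * material kappa'.

Definition rescaling_invariant_flow (kappa : 'M[R]_V) : Prop :=
  forall beta : R, 0 < beta -> forall Q : 'M[R]_V,
    kirchhoff_flow kappa Q <-> kirchhoff_flow (beta *: kappa) Q.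

End Network.

(* Main.v *)
(** Let f(K) be the least dissipation at material K. The infimum is attained: a
    bound on the dissipation gives Q^2 <= C kappa on every edge, so a limit of
    physical networks of bounded dissipation is again physical. Rescaling a
    minimizer at K by (K'/K)^2 keeps its flow, by hypothesis, and multiplies its
    dissipation by (K/K')^2. Hence f(K') <= f(K) (K/K')^2 for all K and K', which
    forces f(K) = c / K^2, with c > 0 because some inflow is nonzero. The penalized
    problem thus reduces to minimizing c / K^2 + a K, whose only minimizer K(a)
    satisfies 2c = a K(a)^3. If no network is physical, both kinds of minimizers
    are absent and any bijection will do. *)

Require Import Defs.
From mathcomp Require Import all_boot all_order all_algebra.
From mathcomp Require Import all_classical all_reals.
From mathcomp Require Import topology normedtype sequences realfun exp.
From mathcomp Require Import ring lra.

Set Implicit Arguments.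
Unset Strict Implicit.
Unset Printing Implicit Defensive.

Import Order.TTheory GRing.Theory Num.Theory.
Import numFieldNormedType.Exports.
Local Open Scope classical_set_scope.
Local Open Scope ring_scope.

(** * Limits along filters and closedness of row spaces *)

(** The segment is compact, so the image filter has a cluster point, and an ultrafilter converges to
    each of its cluster points. *)
Lemma ultrafilter_bounded_cvg (R : realType) (T : Type) (F : set_system T)
    (u : T -> R) (a b : R) :
  UltraFilter F -> (forall t, a <= u t <= b) -> exists l : R, u @ F --> l.
Proof.
move=> FU ub; have FP := @ultra_proper _ _ FU.
have uab : (u @ F) `[a, b]%classic.
  by apply: (@filterE _ F) => t /=; rewrite in_itv /=.
have [l [_ cl]] := @segment_compact R a b _ (fmap_proper_filter u FP) uab.
exists l => A nA; have [//|FA] := in_ultra_setVsetC (u @^-1` A) FU.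
by have [y [/= ? ?]] := cl (~` A) A FA nA.
Qed.

Lemma cvg_sumr (R : realType) (T I : Type) (F : set_system T) (r : seq I)
    (P : pred I) (u : I -> T -> R) (l : I -> R) : Filter F ->
  (forall i, P i -> u i @ F --> l i) ->
  (\sum_(i <- r | P i) u i t) @[t --> F] --> \sum_(i <- r | P i) l i.
Proof.
by move=> FF ul; apply: cvg_big => // -[x y]; apply: add_continuous.
Qed.

Lemma cvgr_inj (R : realType) (T : Type) (F : set_system T)
    {FP : ProperFilter F} (u : T -> R) (l l' : R) :
  u @ F --> l -> u @ F --> l' -> l = l'.
Proof. by apply: (@cvg_unique R^o); exact: norm_hausdorff. Qed.

(** The row space of [A] is the kernel of [cokermx A], a condition that survives entrywise limits.
    Only the products [v t *m A] have to converge, not [v] itself. *)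
Lemma cvg_row_space (R : realType) (T : Type) (F : set_system T) (n m : nat)
    (A : 'M[R]_(n, m)) (v : T -> 'rV[R]_n) (u : 'rV[R]_m) : ProperFilter F ->
  (forall j, ((v t *m A) 0 j) @[t --> F] --> u 0 j) ->
  exists q, u = q *m A.
Proof.
move=> FP vu; suff /submxP[q ->] : (u <= A)%MS by exists q.
rewrite submxE; apply/eqP/rowP => i; rewrite [RHS]mxE.
apply: (@cvgr_inj R T F _ (fun t => (v t *m A *m cokermx A) 0 i)).
  have -> : (u *m cokermx A) 0 i = \sum_j u 0 j * cokermx A j i by rewrite mxE.
  under eq_cvg do rewrite mxE.
  by apply: cvg_sumr => j _; apply: cvgM; [exact: vu|exact: cvg_cst].
by under eq_cvg do rewrite -mulmxA mulmx_coker mulmx0 mxE; exact: cvg_cst.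
Qed.

Lemma sum_mul_delta (R : realType) (n : nat) (f : 'I_n -> R) (k : 'I_n) :
  \sum_i f i * (i == k)%:R = f k.
Proof.
rewrite (bigD1 k) //= eqxx mulr1 big1 ?addr0 // => i /negbTE ->.
by rewrite mulr0.
Qed.

(** * Kirchhoff flows: uniqueness and a priori bounds *)

Section Flows.
Variables (R : realType) (V : nat) (N : prior_network R V).
Implicit Types kappa Q : 'M[R]_V.

(** Energy argument for the difference [d] of two pressure solutions. At every vertex either [d] or
    the net difference flow vanishes, so the sum of [(d k - d l) ^+ 2 * kappa k l] over the edges is
    zero, and hence so is each term. *)
Lemma kirchhoff_flow_unique kappa Q1 Q2 : is_network N kappa ->
  kirchhoff_flow N kappa Q1 -> kirchhoff_flow N kappa Q2 -> Q1 = Q2.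
Proof.
move=> [ksym k0 _] [p1 [Q1E p1P p1F]] [p2 [Q2E p2P p2F]].
pose d k := p1 k - p2 k.
pose f k l := if edge N k l then (d k - d l) * kappa k l else 0.
have fanti k l : f l k = - f k l.
  by rewrite /f edge_sym ksym; case: ifP => _; ring.
have net k : d k * \sum_l f k l = 0.
  have [kP|kP] := boolP (k \in pressureV N).
    by rewrite /d p1P // p2P // subrr mul0r.
  rewrite -big_mkcond /= (eq_bigr (fun l =>
    (p1 k - p1 l) * kappa k l - (p2 k - p2 l) * kappa k l)); last first.
    by move=> l _; rewrite /d; ring.
  by rewrite sumrB p1F // p2F // subrr mulr0.
have s1 : \sum_k \sum_l d k * f k l = 0.
  by rewrite big1 // => k _; rewrite -mulr_sumr net.
have s2 : \sum_k \sum_l d l * f k l = 0.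
  rewrite exchange_big /= big1 // => k _.
  under eq_bigr do rewrite fanti mulrN.
  by rewrite sumrN -mulr_sumr net oppr0.
have energy0 k l : 0 <= (d k - d l) * f k l.
  by rewrite /f; case: ifP; rewrite ?mulr0 // mulrA -expr2 mulr_ge0 ?sqr_ge0.
have : \sum_k \sum_l (d k - d l) * f k l = 0.
  transitivity (\sum_k \sum_l d k * f k l - \sum_k \sum_l d l * f k l).
    by rewrite -sumrB; apply: eq_bigr => k _; rewrite -sumrB;
       apply: eq_bigr => l _; rewrite mulrBl.
  by rewrite s1 s2 subr0.
move=> /eqP; rewrite psumr_eq0 => [/allP sum0|k _]; last exact: sumr_ge0.
apply/matrixP => k l; rewrite Q1E Q2E; case: ifP => // ekl.
have := sum0 k (mem_index_enum k); rewrite /= psumr_eq0 //.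
(* The vanishing term carries the factor [d k - d l] twice. Dropping one copy leaves
   [(d k - d l) * kappa k l = 0], which is the equality of the two flows on this edge. *)
move=> /allP/(_ l (mem_index_enum l)); rewrite /f ekl /= mulrA mulf_eq0.
rewrite mulf_eq0 orbb -mulf_eq0 => /eqP dk0.
by apply/eqP; rewrite -subr_eq0 -mulrBl -dk0 /d; apply/eqP; ring.
Qed.

Lemma physicalP kappa :
  physical N kappa <-> is_network N kappa /\ exists Q, kirchhoff_flow N kappa Q.
Proof.
split=> [[nk [Q [kQ _]]]|[nk [Q kQ]]]; split => //; exists Q => //.
by split => // Q' kQ'; apply: kirchhoff_flow_unique nk kQ kQ'.
Qed.

Lemma kirchhoff_flow_eq0 kappa Q k l :
  kirchhoff_flow N kappa Q -> kappa k l = 0 -> Q k l = 0.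
Proof. by move=> [p [-> _ _]] ->; rewrite mulr0 if_same. Qed.

Lemma kirchhoff_flow_net kappa Q k : kirchhoff_flow N kappa Q ->
  k \notin pressureV N -> \sum_(l | edge N k l) Q k l = inflow N k.
Proof.
move=> [p [QE _ pF]] kP; rewrite -pF //; apply: eq_bigr => l ekl.
by rewrite QE ekl.
Qed.

Lemma kirchhoff_flow_anti kappa Q k l : is_network N kappa ->
  kirchhoff_flow N kappa Q -> Q l k = - Q k l.
Proof.
move=> [ksym _ _] [p [QE _ _]]; rewrite !QE edge_sym ksym.
by case: ifP => _; ring.
Qed.

Lemma dissipation_term_ge0 kappa Q k l :
  is_network N kappa -> 0 <= Q k l ^+ 2 / kappa k l.
Proof. by case=> _ k0 _; rewrite mulr_ge0 ?sqr_ge0 // invr_ge0. Qed.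

Lemma dissipation_ge0 kappa Q : is_network N kappa -> 0 <= dissipation N kappa Q.
Proof.
by move=> nk; apply: sumr_ge0 => k _; apply: sumr_ge0 => l _;
   apply: dissipation_term_ge0.
Qed.

Lemma material_term_ge0 kappa k l :
  edge N k l -> 0 <= Num.sqrt (kappa k l) * weight N k l.
Proof. by move=> ekl; rewrite mulr_ge0 ?sqrtr_ge0 // ltW // weight_gt0. Qed.

Lemma material_ge0 kappa : 0 <= material N kappa.
Proof.
apply: sumr_ge0 => k _; apply: sumr_ge0 => l /andP[_ ekl].
exact: material_term_ge0.
Qed.

Lemma edge_sum_ge_term (f : 'I_V -> 'I_V -> R) k l :
  (forall k l, edge N k l -> 0 <= f k l) -> (forall k l, f k l = f l k) ->
  edge N k l -> f k l <= \sum_(i < V) \sum_(j < V | (j < i)%N && edge N i j) f i j.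
Proof.
move=> f0 fsym.
wlog lk : k l / (l < k)%N => [wlg ekl|ekl].
  have [kl|lk|/val_inj klE] := ltngtP k l.
  - by rewrite fsym; apply: wlg; rewrite // edge_sym.
  - exact: wlg.
  - by move: ekl (edge_irr N k); rewrite klE => ->.
have s0 (i : 'I_V) : 0 <= \sum_(j < V | (j < i)%N && edge N i j) f i j.
  by apply: sumr_ge0 => j /andP[_ eij]; apply: f0.
rewrite (bigD1 k) //= -[leLHS]addr0 lerD ?sumr_ge0 //.
rewrite (bigD1 l) ?lk ?ekl //= -[leLHS]addr0 lerD // sumr_ge0 //.
by move=> j /andP[/andP[_ ekj] _]; apply: f0.
Qed.

(** One edge dissipates at most the total. Bounded dissipation thus bounds the flow in terms of the
    conductance and forces it to vanish wherever the conductance tends to zero. *)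
Lemma sqr_flow_le kappa Q k l : is_network N kappa -> kirchhoff_flow N kappa Q ->
  Q k l ^+ 2 <= dissipation N kappa Q * kappa k l.
Proof.
move=> nk kQ; have [ksym k0 kE] := nk.
have [k00|kn0] := eqVneq (kappa k l) 0.
  by rewrite k00 (kirchhoff_flow_eq0 kQ k00) expr0n mulr0.
have ekl : edge N k l by apply: contraNT kn0 => /kE ->.
rewrite -ler_pdivrMr; last by rewrite lt_neqAle eq_sym kn0 k0.
apply: (@edge_sum_ge_term (fun k l => Q k l ^+ 2 / kappa k l)) => // i j.
  by move=> _; exact: dissipation_term_ge0.
by rewrite (kirchhoff_flow_anti _ _ nk kQ) sqrrN ksym.
Qed.

Lemma conductance_le kappa k l : is_network N kappa ->
  kappa k l <= (material N kappa / weight N k l) ^+ 2.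
Proof.
move=> [ksym k0 kE].
have [ekl|nekl] := boolP (edge N k l); last by rewrite kE // sqr_ge0.
have d0 := weight_gt0 ekl.
rewrite -[leLHS]sqr_sqrtr // lerXn2r ?nnegrE ?sqrtr_ge0 //.
  by rewrite divr_ge0 ?material_ge0 // ltW.
rewrite ler_pdivlMr //.
(* [weight] is symmetric on edges only, so the term is cut off to 0 elsewhere to meet the symmetry
   hypothesis of [edge_sum_ge_term]. *)
pose f i j := if edge N i j then Num.sqrt (kappa i j) * weight N i j else 0.
have fE i j : edge N i j -> f i j = Num.sqrt (kappa i j) * weight N i j.
  by rewrite /f => ->.
rewrite -fE //; apply: (@le_trans _ _ (\sum_(i < V)
    \sum_(j < V | (j < i)%N && edge N i j) f i j)).
  apply: edge_sum_ge_term => // i j; first by move=> eij; rewrite fE ?material_term_ge0.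
  rewrite /f edge_sym ksym; case: ifP => // eji.
  by rewrite (weight_sym eji).
by apply: ler_sum => i _; apply: ler_sum => j /andP[_ eij]; rewrite fE.
Qed.

(** * Passage to the limit and existence of minimizers *)

(* The pressures themselves need not converge, only their differences along
   edges that survive in the limit; the limit pressures exist because the range
   of a linear map is closed. *)
Lemma kirchhoff_flow_lim (T : Type) (F : set_system T) {FP : ProperFilter F}
    (kap Qs : T -> 'M[R]_V) kappa Q (C : R) :
  (forall t, is_network N (kap t)) ->
  (forall t, kirchhoff_flow N (kap t) (Qs t)) ->
  (forall t, dissipation N (kap t) (Qs t) <= C) ->
  (forall k l, (kap t k l) @[t --> F] --> kappa k l) ->
  (forall k l, (Qs t k l) @[t --> F] --> Q k l) ->
  is_network N kappa /\ kirchhoff_flow N kappa Q.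
Proof.
move=> nkap kQs DC ckap cQ.
have nk : is_network N kappa.
  split=> [k l|k l|k l nekl].
  - apply: (cvgr_inj (ckap k l)).
    under eq_cvg do rewrite (let: And3 h _ _ := nkap _ in h k l).
    exact: ckap.
  - apply: (cvgr_to_ge (ckap k l)); apply: nearW => t.
    by have [_ + _] := nkap t; apply.
  - apply: (cvgr_inj (ckap k l)).
    under eq_cvg do rewrite (let: And3 _ _ h := nkap _ in h k l nekl).
    exact: cvg_cst.
split=> //; have [_ k0 kE] := nk.
have /choice[p pP] t : exists p : 'I_V -> R,
  [/\ forall k l, Qs t k l = if edge N k l then (p k - p l) * kap t k l else 0,
      forall k, k \in pressureV N -> p k = pressure N k &
      forall k, k \notin pressureV N ->
        \sum_(l | edge N k l) (p k - p l) * kap t k l = inflow N k].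
  by exact: kQs.
(* The columns of [A] are the linear functionals of the pressures that have a limit: differences
   along pairs of positive limit conductance, and values at pressure vertices. The row [u] below
   collects their limits. *)
pose J : finType := ('I_V * 'I_V + 'I_V)%type.
pose A := \matrix_(i < V, j < #|J|)
  match enum_val j : J with
  | inl (k, l) =>
      if 0 < kappa k l then (i == k)%:R - (i == l)%:R else 0
  | inr k => if k \in pressureV N then (i == k)%:R else 0 : R
  end.
have AE (v : 'I_V -> R) j : ((\row_i v i) *m A) 0 j =
  match enum_val j : J with
  | inl (k, l) => if 0 < kappa k l then v k - v l else 0
  | inr k => if k \in pressureV N then v k else 0
  end.
  rewrite mxE; under eq_bigr do rewrite !mxE.
  case: (enum_val j) => [[k l]|k]; case: ifP => _.
  - under eq_bigr do rewrite mulrBr.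
    by rewrite sumrB !sum_mul_delta.
  - by rewrite big1 // => i _; rewrite mulr0.
  - by rewrite sum_mul_delta.
  - by rewrite big1 // => i _; rewrite mulr0.
pose u : 'rV[R]_#|J| := \row_j
  match enum_val j : J with
  | inl (k, l) => if 0 < kappa k l then Q k l / kappa k l else 0
  | inr k => if k \in pressureV N then pressure N k else 0
  end.
have [q uE] : exists q, u = q *m A.
  apply: (@cvg_row_space _ _ F _ _ A (fun t => \row_i p t i)) => j.
  rewrite [u 0 j]mxE; under eq_cvg do rewrite AE.
  case: (enum_val j) => [[k l]|k]; case: ifPn => kp; try exact: cvg_cst.
    have ekl : edge N k l.
      by apply: contraTT kp => /kE ->; rewrite ltxx.
    have : (Qs t k l / kap t k l) @[t --> F] --> Q k l / kappa k l.
      by apply: cvgM; [exact: cQ|apply: cvgV; [rewrite gt_eqF|exact: ckap]].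
    apply: cvg_trans; apply: near_eq_cvg; near=> t.
    have kt : 0 < kap t k l by near: t; exact: (cvgr_gt _ (ckap k l)).
    by have [-> _ _] := pP t; rewrite ekl mulfK // gt_eqF.
  apply: cvg_trans (@cvg_cst _ (pressure N k) _ F _); apply: near_eq_cvg.
  by apply: nearW => t; have [_ pt _] := pP t; rewrite pt.
have AEq j : u 0 j = match enum_val j : J with
  | inl (k, l) => if 0 < kappa k l then q 0 k - q 0 l else 0
  | inr k => if k \in pressureV N then q 0 k else 0
  end.
  by rewrite uE -(AE (q 0)); congr ((_ *m _) _ _); apply/rowP => i; rewrite mxE.
have QE k l : Q k l = if edge N k l then (q 0 k - q 0 l) * kappa k l else 0.
  case: ifPn => ekl; last first.
    apply: (cvgr_inj (cQ k l)).
    under eq_cvg do rewrite (let: And3 h _ _ := pP _ in h k l) (negbTE ekl).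
    exact: cvg_cst.
  have := k0 k l; rewrite le_eqVlt => /predU1P[k00|kp].
    (* No pressure difference is controlled here, but the bound of [sqr_flow_le] passes to the limit
       and gives [Q k l = 0]. *)
    have : 0 <= C * kappa k l - Q k l ^+ 2.
      apply: (@cvgr_to_ge _ F _ _ (fun t => C * kap t k l - Qs t k l ^+ 2)).
        apply: cvgB; first by apply: cvgM; [exact: cvg_cst|exact: ckap].
        by rewrite expr2; under eq_cvg do rewrite expr2; apply: cvgM; exact: cQ.
      apply: nearW => t; rewrite subr_ge0.
      apply: (le_trans (sqr_flow_le k l (nkap t) (kQs t))).
      by rewrite ler_wpM2r //; have [_ + _] := nkap t; apply.
    rewrite -k00 !mulr0 sub0r oppr_ge0 => Q0.
    by apply/eqP; rewrite -sqrf_eq0 eq_le Q0 sqr_ge0.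
  have := AEq (enum_rank (inl (k, l) : J)).
  by rewrite mxE enum_rankK kp => <-; rewrite divfK // gt_eqF.
exists (q 0); split=> [//|k kP|k kP].
  by have := AEq (enum_rank (inr k : J)); rewrite mxE enum_rankK kP.
(* Vertex balance is checked on the flows, which converge although the pressures may not. *)
have -> : \sum_(l | edge N k l) (q 0 k - q 0 l) * kappa k l
    = \sum_(l | edge N k l) Q k l.
  by apply: eq_bigr => l ekl; rewrite QE ekl.
apply: (@cvgr_inj _ _ F _ (fun t => \sum_(l | edge N k l) Qs t k l)).
  by apply: cvg_sumr => l _; exact: cQ.
under eq_cvg do rewrite (kirchhoff_flow_net (kQs _) kP).
exact: cvg_cst.
Unshelve. all: by end_near. Qed.

Lemma cvg_material (T : Type) (F : set_system T) {FF : Filter F}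
    (kap : T -> 'M[R]_V) kappa :
  (forall k l, (kap t k l) @[t --> F] --> kappa k l) ->
  material N (kap t) @[t --> F] --> material N kappa.
Proof.
move=> ckap; apply: cvg_sumr => k _; apply: cvg_sumr => l _.
apply: cvgM; last exact: cvg_cst.
exact: (continuous_cvg FF (@sqrt_continuous R _) (ckap k l)).
Qed.

(* Edges whose conductance vanishes in the limit may lose dissipation, hence only
   an inequality. *)
Lemma dissipation_lim_le (T : topologicalType) (F : set_system T)
    {FP : ProperFilter F} (kap Qs : T -> 'M[R]_V) kappa Q (B : T -> R) (b : R) :
  (forall t, is_network N (kap t)) -> is_network N kappa ->
  (forall t, dissipation N (kap t) (Qs t) <= B t) ->
  (forall k l, (kap t k l) @[t --> F] --> kappa k l) ->
  (forall k l, (Qs t k l) @[t --> F] --> Q k l) ->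
  B @ F --> b -> dissipation N kappa Q <= b.
Proof.
move=> nkap nk DB ckap cQ cB; have [_ k0 _] := nk.
(* [g] keeps only the edges of positive limit conductance. It converges to the limit dissipation and
   stays below the dissipation at each [t]. *)
pose g t := \sum_(k < V) \sum_(l < V | (l < k)%N && edge N k l)
  if 0 < kappa k l then Qs t k l ^+ 2 / kap t k l else 0.
have cg : g @ F --> dissipation N kappa Q.
  apply: cvg_sumr => k _; apply: cvg_sumr => l _; rewrite /=.
  have [kp|kp] := ltP 0 (kappa k l).
    apply: cvgM; last by apply: cvgV; [rewrite gt_eqF|exact: ckap].
    by rewrite expr2; under eq_cvg do rewrite expr2; apply: cvgM; exact: cQ.
  have -> : kappa k l = 0.
    by apply/eqP; rewrite eq_le k0 kp.
  by rewrite invr0 mulr0; exact: cvg_cst.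
apply: (ler_cvg_to cg cB); apply: nearW => t; apply: le_trans (DB t).
apply: ler_sum => k _; apply: ler_sum => l _; case: ifP => // _.
exact: dissipation_term_ge0.
Qed.

(** Direct method: along a minimizing sequence the material bounds the conductances, and these
    together with the dissipation bound the flows, so a limit exists and is admissible. *)
Lemma min_dissipative_exists kappa0 : physical N kappa0 ->
  exists kappa, min_dissipative_constraint N (material N kappa0) kappa.
Proof.
set K := material N kappa0; move=> /physicalP[nk0 [Q0 kQ0]].
pose E := [set D | exists kappaQ : 'M[R]_V * 'M[R]_V,
  [/\ is_network N kappaQ.1, kirchhoff_flow N kappaQ.1 kappaQ.2,
    material N kappaQ.1 = K & D = dissipation N kappaQ.1 kappaQ.2]].
have E0 : lbound E 0 by move=> _ [[kappa Q] [? _ _ ->]]; exact: dissipation_ge0.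
have infE : has_inf E.
  split; last by exists 0.
  by exists (dissipation N kappa0 Q0); exists (kappa0, Q0).
have /choice[s sP] (n : nat) : exists kappaQ : 'M[R]_V * 'M[R]_V,
    [/\ is_network N kappaQ.1, kirchhoff_flow N kappaQ.1 kappaQ.2,
      material N kappaQ.1 = K
      & dissipation N kappaQ.1 kappaQ.2 <= inf E + harmonic n].
  have [D [kappaQ [? ? ? ->]] /ltW ?] := inf_adherent (@harmonic_gt0 R n) infE.
  by exists kappaQ.
(* A single ultrafilter finer than [\oo] makes all entries converge at once, without successive
   extraction of subsequences. *)
have [U [UU ooU]] := @ultraFilterLemma nat \oo _.
have UP := @ultra_proper _ _ UU.
pose kap n := (s n).1; pose Qs n := (s n).2.
have nkap n : is_network N (kap n) by have [] := sP n.
have kQs n : kirchhoff_flow N (kap n) (Qs n) by have [] := sP n.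
have mK n : material N (kap n) = K by have [] := sP n.
have DI n : dissipation N (kap n) (Qs n) <= inf E + harmonic n by have [] := sP n.
have D1 n : dissipation N (kap n) (Qs n) <= inf E + 1.
  apply: le_trans (DI n) _; rewrite lerD2l /harmonic /= invf_le1 ?ltr0n //.
  by rewrite ler1n.
have kap_le n k l : 0 <= kap n k l <= (K / weight N k l) ^+ 2.
  by rewrite -(mK n) conductance_le // andbT; have [_ + _] := nkap n; apply.
have inf0 : 0 <= inf E by exact: lb_le_inf infE.1 E0.
have /choice[kf kfP] (kl : 'I_V * 'I_V) :
    exists x : R, (kap n kl.1 kl.2) @[n --> U] --> x.
  by apply: ultrafilter_bounded_cvg UU _ => n; exact: kap_le.
have /choice[Qf QfP] (kl : 'I_V * 'I_V) :
    exists x : R, (Qs n kl.1 kl.2) @[n --> U] --> x.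
  case: kl => k l /=; pose b := (inf E + 1) * (K / weight N k l) ^+ 2.
  (* A square of at most [b] puts the number itself between [- (b + 1)] and [b + 1], which avoids a
     square root. *)
  apply: (@ultrafilter_bounded_cvg _ _ _ _ (- (b + 1)) (b + 1)) => n.
  have b0 : 0 <= b by rewrite mulr_ge0 ?sqr_ge0 ?addr_ge0.
  have : Qs n k l ^+ 2 <= b.
    apply: (le_trans (sqr_flow_le k l (nkap n) (kQs n))).
    have /andP[kn0 knb] := kap_le n k l.
    by apply: ler_pM => //; exact: dissipation_ge0.
  by move=> Qb; apply/andP; split; nra.
pose kappa : 'M[R]_V := \matrix_(k, l) kf (k, l).
pose Q : 'M[R]_V := \matrix_(k, l) Qf (k, l).
have ckap k l : (kap n k l) @[n --> U] --> kappa k l.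
  by rewrite /kappa mxE; exact: kfP (k, l).
have cQ k l : (Qs n k l) @[n --> U] --> Q k l.
  by rewrite /Q mxE; exact: QfP (k, l).
have [nk kQ] := kirchhoff_flow_lim nkap kQs D1 ckap cQ.
have kappaK : material N kappa = K.
  apply: (cvgr_inj (cvg_material ckap)).
  by under eq_cvg do rewrite mK; exact: cvg_cst.
have cB : (inf E + harmonic n) @[n --> U] --> inf E.
  rewrite -[X in _ --> X]addr0; apply: cvgD; first exact: cvg_cst.
  by move=> A /(@cvg_harmonic R) /ooU.
have DE : dissipation N kappa Q <= inf E.
  exact: (dissipation_lim_le nkap nk DI ckap cQ cB).
exists kappa; split=> //; first by apply/physicalP; split => //; exists Q.
move=> kappa' /physicalP[nk' _] mk' Q1 Q' kQ1 kQ'.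
rewrite (kirchhoff_flow_unique nk kQ1 kQ); apply: le_trans DE _.
by apply: ge_inf; [exists 0|exists (kappa', Q')].
Qed.

(** * Positivity and the scaling law *)

(** Zero dissipation would make every flow vanish by [sqr_flow_le], contradicting the balance at a
    flow vertex of nonzero inflow. *)
Lemma dissipation_gt0 kappa Q :
  (exists2 k, k \in flowV N & inflow N k != 0) ->
  is_network N kappa -> kirchhoff_flow N kappa Q -> 0 < dissipation N kappa Q.
Proof.
move=> [k kF qk] nk kQ; rewrite lt_neqAle dissipation_ge0 // andbT.
apply: contra_neq qk => /esym D0.
rewrite -(kirchhoff_flow_net kQ); last by rewrite (disjointFl (bc_disjoint N)).
apply: big1 => l _; apply/eqP; rewrite -sqrf_eq0 eq_le sqr_ge0 andbT.
by apply: le_trans (sqr_flow_le k l nk kQ) _; rewrite D0 mul0r.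
Qed.

(** Zero material would make every conductance, and with it the dissipation, vanish. *)
Lemma material_gt0 kappa Q :
  (exists2 k, k \in flowV N & inflow N k != 0) ->
  is_network N kappa -> kirchhoff_flow N kappa Q -> 0 < material N kappa.
Proof.
move=> qN nk kQ; rewrite lt_neqAle material_ge0 // andbT.
have := dissipation_gt0 qN nk kQ; apply: contraTneq => /esym M0.
rewrite -leNgt; apply: sumr_le0 => k _; apply: sumr_le0 => l _.
have k00 : kappa k l = 0.
  apply/eqP; rewrite eq_le; have [_ -> _] := nk; rewrite andbT.
  by have := conductance_le k l nk; rewrite M0 mul0r expr0n.
by rewrite k00 invr0 mulr0.
Qed.

Lemma dissipationZ (beta : R) kappa Q :
  dissipation N (beta *: kappa) Q = beta^-1 * dissipation N kappa Q.
Proof.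
rewrite mulr_sumr; apply: eq_bigr => k _; rewrite mulr_sumr.
by apply: eq_bigr => l _; rewrite mxE invfM mulrCA.
Qed.

Lemma materialZ (beta : R) kappa : 0 <= beta ->
  material N (beta *: kappa) = Num.sqrt beta * material N kappa.
Proof.
move=> b0; rewrite mulr_sumr; apply: eq_bigr => k _; rewrite mulr_sumr.
by apply: eq_bigr => l _; rewrite mxE sqrtrM // mulrA.
Qed.

Lemma is_networkZ (beta : R) kappa : 0 <= beta ->
  is_network N kappa -> is_network N (beta *: kappa).
Proof.
move=> b0 [ksym k0 kE]; split=> k l; rewrite !mxE; first by rewrite ksym.
  by rewrite mulr_ge0.
by move=> /kE ->; rewrite mulr0.
Qed.

Lemma rescale_to_material kappa Q (K : R) : rescaling_invariant_flow N kappa ->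
  is_network N kappa -> kirchhoff_flow N kappa Q -> 0 < material N kappa ->
  0 < K -> exists kappa', [/\ is_network N kappa', kirchhoff_flow N kappa' Q,
    material N kappa' = K & dissipation N kappa' Q
      = dissipation N kappa Q * material N kappa ^+ 2 / K ^+ 2].
Proof.
move=> inv nk kQ M0 K0; pose b := K / material N kappa.
(* Material grows like the square root of the conductances, so the scaling factor is [b ^+ 2]. *)
have b0 : 0 < b by rewrite divr_gt0.
exists (b ^+ 2 *: kappa); split.
- by apply: is_networkZ => //; exact: sqr_ge0.
- by apply/inv => //; exact: exprn_gt0.
- by rewrite materialZ ?sqr_ge0 // sqrtr_sqr gtr0_norm // divfK // gt_eqF.
- rewrite dissipationZ /b expr_div_n invf_div mulrC mulrA; congr (_ / _).
Qed.

Lemma min_dissipation_scaling :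
  (exists2 k, k \in flowV N & inflow N k != 0) ->
  (forall K : R, 0 < K -> forall kappa : 'M[R]_V,
     min_dissipative_constraint N K kappa -> rescaling_invariant_flow N kappa) ->
  (exists kappa, physical N kappa) ->
  exists c : R, [/\ 0 < c,
    forall kappa Q, is_network N kappa -> kirchhoff_flow N kappa Q ->
      c / material N kappa ^+ 2 <= dissipation N kappa Q
  & forall K, 0 < K -> exists kappa Q, [/\ is_network N kappa,
      kirchhoff_flow N kappa Q, material N kappa = K
      & dissipation N kappa Q = c / K ^+ 2]].
Proof.
move=> qN inv [kappa0 pk0]; have [kappa1 min1] := min_dissipative_exists pk0.
have [/physicalP[nk1 [Q1 kQ1]] mk1 opt1] := min1.
have M1 := material_gt0 qN nk1 kQ1.
have inv1 : rescaling_invariant_flow N kappa1 by apply: (inv _ _ _ min1); rewrite -mk1.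
(* The constant is read off from one minimizer [kappa1], at whatever material it has. *)
exists (dissipation N kappa1 Q1 * material N kappa1 ^+ 2); split.
- by rewrite mulr_gt0 ?exprn_gt0 // dissipation_gt0.
- move=> kappa Q nk kQ; have M0 := material_gt0 qN nk kQ.
  have pk : physical N kappa by apply/physicalP; split=> //; exists Q.
  have [kappa2 min2] := min_dissipative_exists pk.
  have [/physicalP[nk2 [Q2 kQ2]] mk2 opt2] := min2.
  have M2 := material_gt0 qN nk2 kQ2.
  (* [kappa3] is the minimizer at the material of [kappa], rescaled to the material of [kappa1]. The
     optimality of [kappa1] against it is the required lower bound. *)
  have [kappa3 [nk3 kQ3 mk3 D3]] :=
    rescale_to_material (inv _ M0 _ min2) nk2 kQ2 M2 M1.
  have pk3 : physical N kappa3 by apply/physicalP; split=> //; exists Q2.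
  apply: le_trans (opt2 _ pk erefl _ _ kQ2 kQ).
  rewrite ler_pdivrMr ?exprn_gt0 // -ler_pdivlMr ?exprn_gt0 // -mk2 -D3.
  by apply: opt1 => //; rewrite mk3.
- move=> K K0; have [kappa2 [? ? ? ?]] := rescale_to_material inv1 nk1 kQ1 M1 K0.
  by exists kappa2, Q1.
Qed.

End Flows.

(** * The one-variable problem and its critical point *)

(** The relation between [c] and [K0] says that [K0] is a critical point of [c / K ^+ 2 + a * K],
    whence the double root. The remaining factor is positive for positive [a], which gives a strict
    global minimum. *)
Lemma penalty_sub (R : realType) (a c K0 K : R) : 0 < K0 -> 0 < K ->
  2 * c = a * K0 ^+ 3 ->
  c / K ^+ 2 + a * K - (c / K0 ^+ 2 + a * K0) =
  a * (2 * K + K0) / (2 * K ^+ 2) * (K - K0) ^+ 2.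
Proof.
move=> K00 Kp cE; have -> : c = a * K0 ^+ 3 / 2 by rewrite -cE; field.
by field; rewrite !gt_eqF.
Qed.

Lemma penalty_min (R : realType) (a c K0 K : R) : 0 < a -> 0 < K0 -> 0 < K ->
  2 * c = a * K0 ^+ 3 ->
  c / K0 ^+ 2 + a * K0 <= c / K ^+ 2 + a * K ?= iff (K == K0).
Proof.
move=> a0 K00 Kp cE.
have coef : 0 < a * (2 * K + K0) / (2 * K ^+ 2).
  by rewrite divr_gt0 ?mulr_gt0 ?addr_gt0 ?exprn_gt0 ?mulr_gt0.
apply/leifP; case: eqVneq => [->//|KK0]; rewrite -subr_gt0 penalty_sub //.
by rewrite mulr_gt0 // exprn_even_gt0 // subr_eq0.
Qed.

Lemma cube_root_bij (R : realType) (c : R) : 0 < c ->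
  exists Kof : R -> R,
    set_bij [set a : R | 0 < a] [set K : R | 0 < K] Kof /\
    forall a, 0 < a -> 2 * c = a * Kof a ^+ 3.
Proof.
move=> c0; pose Kof (a : R) := (2 * c / a) `^ (3^-1).
have Kof0 a : 0 < a -> 0 < Kof a.
  by move=> a0; rewrite powR_gt0 // divr_gt0 // mulr_gt0.
have Kof3 a : 0 < a -> 2 * c = a * Kof a ^+ 3.
  move=> a0; rewrite -powR_mulrn ?powR_ge0 // -powRrM mulVf ?pnatr_eq0 //.
  rewrite powRr1 ?ltW ?divr_gt0 ?mulr_gt0 //.
  by rewrite mulrCA divff ?mulr1 // gt_eqF.
exists Kof; split=> //; split=> [a /=|a a' /set_mem /= a0 /set_mem /= a'0 KE|K /= K0].
- exact: Kof0.
(* Equal values of [Kof] have equal nonzero cubes, which cancel from the two defining relations. *)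
- have := Kof3 a a0; rewrite KE (Kof3 a' a'0) => /esym; apply: mulIf.
  by rewrite gt_eqF // exprn_gt0 // Kof0.
- have a0 : 0 < 2 * c / K ^+ 3 by rewrite divr_gt0 ?mulr_gt0 ?exprn_gt0.
  exists (2 * c / K ^+ 3) => //.
  have := Kof3 _ a0; set x := Kof _ => xE.
  have x0 : 0 < x by exact: Kof0.
  apply/eqP; rewrite -(eqrXn2 (n := 3)) ?ltW //; apply/eqP.
  apply: (@mulfI _ (2 * c / K ^+ 3)); first by rewrite gt_eqF.
  by rewrite -xE divfK // gt_eqF // exprn_gt0.
Qed.

Theorem proposition3p11 (R : realType) (V : nat) (N : prior_network R V)
  (inflow_neq0 : exists2 k, k \in flowV N & inflow N k != 0)
  (flow_invariant : forall K : R, 0 < K -> forall kappa : 'M[R]_V,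
     min_dissipative_constraint N K kappa -> rescaling_invariant_flow N kappa) :
  exists Kof : R -> R,
    set_bij [set a : R | 0 < a] [set K : R | 0 < K] Kof /\
    forall a : R, 0 < a -> forall kappa : 'M[R]_V,
      min_dissipative_constraint N (Kof a) kappa <->
      min_dissipative_penalty N a kappa.
Proof.
have [pN|nopN] := pselect (exists kappa, physical N kappa); last first.
  exists id; split; first by split=> // K K0; exists K.
  by move=> a _ kappa; split=> [[pk]|[pk]]; case: nopN; exists kappa.
have [c [c0 Dge Dopt]] := min_dissipation_scaling inflow_neq0 flow_invariant pN.
have [Kof [bijK KofE]] := cube_root_bij c0.
exists Kof; split=> // a a0 kappa.
have K0 : 0 < Kof a by have [+ _ _] := bijK; apply.
(* This network attains the minimal penalized value [c / Kof a ^+ 2 + a * Kof a] and is the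
   competitor in both directions. *)
have [kappa1 [Q1 [nk1 kQ1 mk1 D1]]] := Dopt _ K0.
have pk1 : physical N kappa1 by apply/physicalP; split=> //; exists Q1.
split=> [[pk mk opt]|[pk opt]]; split=> //.
- move=> kappa' /physicalP[nk' _] Q Q' kQ kQ'.
  have M' := material_gt0 inflow_neq0 nk' kQ'.
  have := opt _ pk1 mk1 _ _ kQ kQ1; have := Dge _ _ nk' kQ'.
  have := (penalty_min a0 K0 M' (KofE a a0)).1; rewrite D1 mk; lra.
(* Comparison with [kappa1] bounds the one-variable function at [material N kappa] by its minimum,
   and the equality case of [penalty_min] then fixes the material. *)
- have /physicalP[nk [Q kQ]] := pk.
  have M := material_gt0 inflow_neq0 nk kQ.
  apply/eqP; rewrite -(ge_leif (penalty_min a0 K0 M (KofE a a0))).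
  by have := opt _ pk1 _ _ kQ kQ1; have := Dge _ _ nk kQ; rewrite D1 mk1; lra.
- move=> kappa' /physicalP[nk' _] mk' Q Q' kQ kQ'; have /physicalP[nk _] := pk.
  have M := material_gt0 inflow_neq0 nk kQ.
  have := opt _ pk1 _ _ kQ kQ1; have := Dge _ _ nk' kQ'; rewrite D1 mk1 mk'.
  have := Dge _ _ nk kQ => DM D' TM.
  have ME : material N kappa = Kof a.
    by apply/eqP; rewrite -(ge_leif (penalty_min a0 K0 M (KofE a a0))); lra.
  (* With equal material the penalty terms cancel, so [kappa] dissipates at most [c / Kof a ^+ 2],
     the lower bound for [kappa']. *)
  by move: TM; rewrite ME; lra.
Qed.
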